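(* Consider the $2$-norm safe set $\mathcal{S}_{x^a}^2=\{x\in\mathbb{R}^n:\|x\|_2^2\leq1\}$ and the corresponding optimal $\alpha$-stealthy bias injection attack parameterized by the optimization problem $$\max_{a_\infty}\ \|G_{xa}a_\infty\|_2^2\quad\text{s.t.}\quad \|G_{ra}a_\infty\|_2^2\leq\delta_\alpha^2,$$ which is assumed to be bounded. Denote $\lambda^*$ and $v^*$ as the largest generalized eigenvalue and corresponding unit-norm eigenvector of the matrix pencil $(G_{xa}^\top G_{xa},\,G_{ra}^\top G_{ra})$. The optimal bias injection attack is given by $$a^*_\infty=\pm\frac{\delta_\alpha}{\|G_{ra}v^*\|_2}v^*,$$ and the corresponding optimal value is $\|G_{xa}a^*_\infty\|_2^2=\lambda^*\delta_\alpha^2$. Moreover, at steady state the system is in a safe state if and only if $\lambda^*\delta_\alpha^2\leq1$.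
   Context: $\delta_\alpha>0$ is a real number and $a_\infty$ is a constant (steady-state) attack bias, a real vector. The matrices $G_{xa}$ and $G_{ra}$ are the steady-state gains from the bias to the attack component of the plant state ($x^a_\infty=G_{xa}a_\infty$) and to the attack component of the detector residual ($r^a_\infty=G_{ra}a_\infty$): $$G_{xa}=[I\ \ 0](I-\mathbf{A})^{-1}\mathbf{B},\qquad G_{ra}=\mathbf{C}_e(I-\mathbf{A}_e)^{-1}\mathbf{B}_e+\mathbf{D}_e .$$ They come from the attack-induced closed-loop dynamics $\eta^a_{k+1}=\mathbf{A}\eta^a_k+\mathbf{B}a_k$, with $\eta^a_k=[x_k^{a\top}\ z_k^{a\top}]^\top$ (plant state component $x^a_k\in\mathbb{R}^n$ and controller state component $z^a_k\in\mathbb{R}^m$), and the attack-induced anomaly detector error dynamics $\xi^a_{k|k}=\mathbf{A}_e\xi^a_{k-1|k-1}+\mathbf{B}_ea_{k-1}$, $r^a_k=\mathbf{C}_e\xi^a_{k-1|k-1}+\mathbf{D}_ea_{k-1}$, where $a_k$ is the attack vector. Here $$\mathbf{A}=\begin{bmatrix} A+BD_cC & BC_c \\ B_cC & A_c \end{bmatrix},\quad \mathbf{A}_e=(I-KC)A,\quad \mathbf{C}_e=VC(I-KC)A,$$ where $A,B,C$ are the plant matrices (state, input, output), $A_c,B_c,C_c,D_c$ are the state-space matrices of the linear output-feedback controller, and $K,V$ are the observer gain and residual weighting of the detector; $\mathbf{B},\mathbf{B}_e,\mathbf{D}_e$ are real matrices of compatible dimensions describing how the attack vector enters. An attack signal is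 $\alpha$-stealthy if $\|r^a_k\|<\delta_\alpha$ for all $k$ from the start of the attack; for the bias injection attack, stealthiness is considered at steady state through the constraint $\|G_{ra}a_\infty\|_2\le\delta_\alpha$, and the largest $\alpha$-stealthy biases are those with $\|G_{ra}a_\infty\|_2=\delta_\alpha$. The system is said to be in a safe state if $x^a_k\in\mathcal{S}_{x^a}^2$; at steady state under the optimal attack this means $x^a_\infty=G_{xa}a^*_\infty\in\mathcal{S}_{x^a}^2$. The optimization problem is bounded if its objective is bounded above on the feasible set. A scalar $\lambda$ is a generalized eigenvalue of a pencil $(P,Q)$ if $\mathrm{rank}(P-\lambda Q)<\mathrm{normalrank}(P,Q)$, where $\mathrm{normalrank}(P,Q)$ is the rank of $P-\nu Q$ for almost all $\nu\in\mathbb{C}$. A generalized eigenvector associated with $\lambda$ is a vector $v$ with $(P-\lambda Q)v=0$ and $v\notin\ker(Q)$. *)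

(* Defs.v *)
From mathcomp Require Import all_boot all_order all_algebra.
From mathcomp Require Import complex.
From mathcomp Require Import boolp classical_sets cardinality reals.
Set Implicit Arguments.
Unset Strict Implicit.
Unset Printing Implicit Defensive.
Import Order.TTheory GRing.Theory Num.Theory.
Local Open Scope classical_set_scope.
Local Open Scope ring_scope.

(* The norm that the libraries put on matrices is the max norm. *)
Definition norm2 (R : realType) (n : nat) (x : 'cV[R]_n) : R :=
  Num.sqrt (\sum_(i < n) x i 0 ^+ 2).

Section Gains.
Variables (R : realType) (n m p q r l : nat).
Variables (A : 'M[R]_n) (B : 'M[R]_(n, p)) (C : 'M[R]_(q, n)).
Variables (Ac : 'M[R]_m) (Bc : 'M[R]_(m, q)) (Cc : 'M[R]_(p, m))
          (Dc : 'M[R]_(p, q)).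
Variables (K : 'M[R]_(n, q)) (V : 'M[R]_(r, q)).
Variables (Ba : 'M[R]_(n + m, l)) (Be : 'M[R]_(n, l)) (De : 'M[R]_(r, l)).

Definition closed_loop_mx : 'M[R]_(n + m) :=
  block_mx (A + B *m Dc *m C) (B *m Cc) (Bc *m C) Ac.

Definition error_mx : 'M[R]_n := (1%:M - K *m C) *m A.

Definition error_output_mx : 'M[R]_(r, n) :=
  V *m C *m (1%:M - K *m C) *m A.

(* [invmx M] is [M] itself when [M] is singular: the two gains below are
   meaningful only if [1%:M - closed_loop_mx] and [1%:M - error_mx] are
   invertible. *)
Definition gain_xa : 'M[R]_(n, l) :=
  row_mx 1%:M 0 *m invmx (1%:M - closed_loop_mx) *m Ba.

Definition gain_ra : 'M[R]_(r, l) :=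
  error_output_mx *m invmx (1%:M - error_mx) *m Be + De.

End Gains.

Section Pencil.
Variables (F : fieldType) (m n : nat) (P Q : 'M[F]_(m, n)).

(* "Almost all" means all but finitely many; over an infinite field at most
   one [k] qualifies. *)
Definition is_normalrank (k : nat) : Prop :=
  finite_set [set nu : F | \rank (P - nu *: Q) <> k].

Definition generalized_eigenvalue (lam : F) : Prop :=
  exists2 k, is_normalrank k & (\rank (P - lam *: Q)%R < k)%N.

Definition generalized_eigenvector (lam : F) (v : 'cV[F]_n) : Prop :=
  (P - lam *: Q) *m v = 0 /\ Q *m v <> 0.

End Pencil.

(* The pencil is regarded over the complex numbers. The maximum is taken over
   its real generalized eigenvalues, non-real ones not being comparable with
   [lam]. *)
Definition largest_generalized_eigenvalue (R : realType) (m n : nat)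
    (P Q : 'M[R]_(m, n)) (lam : R) : Prop :=
  let eig (mu : R) := generalized_eigenvalue
    (map_mx (real_complex R) P) (map_mx (real_complex R) Q)
    (real_complex R mu) in
  eig lam /\ forall mu : R, eig mu -> mu <= lam.

Section Attack.
Variables (R : realType) (n r l : nat).
Variables (Gxa : 'M[R]_(n, l)) (Gra : 'M[R]_(r, l)) (delta : R).

Definition stealthy_biases : set 'cV[R]_l :=
  [set a | norm2 (Gra *m a) ^+ 2 <= delta ^+ 2].

Definition impact (a : 'cV[R]_l) : R := norm2 (Gxa *m a) ^+ 2.

Definition bounded_attack_problem : Prop :=
  has_ubound [set impact a | a in stealthy_biases].

Definition optimal_attack (a : 'cV[R]_l) : Prop :=
  stealthy_biases a /\ forall b, stealthy_biases b -> impact b <= impact a.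

End Attack.

Definition safe_set2 (R : realType) (n : nat) : set 'cV[R]_n :=
  [set x | norm2 x ^+ 2 <= 1].

(* Main.v *)
Require Import Defs.
From mathcomp Require Import all_boot all_order all_algebra.
From mathcomp Require Import complex.
From mathcomp Require Import boolp classical_sets cardinality reals.
From mathcomp Require Import ring lra.
Set Implicit Arguments.
Unset Strict Implicit.
Unset Printing Implicit Defensive.
Import Order.TTheory GRing.Theory Num.Theory.
Local Open Scope classical_set_scope.
Local Open Scope ring_scope.

(** Write [P] and [Q] for the Gram matrices [Gxa^T *m Gxa] and
[Gra^T *m Gra], so that the problem compares the quadratic forms
x |-> |Gxa x|^2 and x |-> |Gra x|^2.  An eigenvector [v] with eigenvalue [lam]
satisfies |Gxa v|^2 = lam |Gra v|^2, hence the scaled bias [a] lies on the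
boundary of the stealthy set and has impact lam delta^2.  What remains is that
no stealthy bias does better, for which |Gxa x|^2 <= lam |Gra x|^2 for all [x]
suffices, as [lam >= 0].

Call [t] a ratio bound if |Gxa x|^2 <= t |Gra x|^2 for all [x].  Boundedness
of the problem provides one by homogeneity ([ratio_bound_of_bounded]), and
the infimum [mu] of the ratio bounds is again a ratio bound
([least_ratio_bound]).  It is enough to see that [mu] is a generalized
eigenvalue, for then [mu <= lam] by maximality of [lam].

For a ratio bound [t], the form of [t *: Q - P] is nonnegative.  For
[t = nu > mu], this form vanishes only on ker Q, so [P - nu *: Q] has the rank of [Q].  At
[mu] the rank must be smaller: with the same rank, [mu *: Q - P] would be
positive semidefinite with kernel ker Q, hence would dominate [e *: Q] for
some [e > 0] ([gram_le_psd]), and [mu - e] would still be a ratio bound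
([least_ratio_bound_rank]).  Since all but finitely many [nu] realize the normal
rank, some real [nu > mu] does, so the drop at [mu] is a drop below the normal
rank ([least_ratio_bound_le]).  The ranks over the complex numbers and over the
reals agree for real parameters.

The domination argument is purely algebraic: no compactness of the unit sphere
and no spectral theorem is involved. *)

Definition qform (R : realType) (n : nat) (M : 'M[R]_n) (x : 'cV[R]_n) : R :=
  (x^T *m M *m x) 0 0.

Section QuadraticForms.
Variable R : realType.

Lemma qformB n (M N : 'M[R]_n) (x : 'cV_n) :
  qform (M - N) x = qform M x - qform N x.
Proof. by rewrite /qform mulmxBr mulmxBl !mxE. Qed.

Lemma qformZl n t (M : 'M[R]_n) (x : 'cV_n) : qform (t *: M) x = t * qform M x.
Proof. by rewrite /qform -scalemxAr -scalemxAl mxE. Qed.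

Lemma qformZr n t (M : 'M[R]_n) (x : 'cV_n) :
  qform M (t *: x) = t ^+ 2 * qform M x.
Proof.
by rewrite /qform [(t *: x)^T]linearZ /= -!scalemxAl -scalemxAr !mxE mulrA.
Qed.

Lemma qform_congr m n (M : 'M[R]_m) (G : 'M_(m, n)) (x : 'cV_n) :
  qform (G^T *m M *m G) x = qform M (G *m x).
Proof. by rewrite /qform trmx_mul !mulmxA. Qed.

Lemma qform_gram m n (G : 'M[R]_(m, n)) (x : 'cV_n) :
  qform (G^T *m G) x = norm2 (G *m x) ^+ 2.
Proof.
rewrite /norm2 sqr_sqrtr ?sumr_ge0// => [|i _]; last exact: sqr_ge0.
rewrite -[G^T]mulmx1 qform_congr /qform mulmx1 mxE.
by apply: eq_bigr => i _; rewrite [in LHS]mxE expr2.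
Qed.

Lemma norm2_sqr_eq0 n (x : 'cV[R]_n) : norm2 x ^+ 2 = 0 -> x = 0.
Proof.
rewrite /norm2 sqr_sqrtr ?sumr_ge0// => [|i _]; last exact: sqr_ge0.
move/eqP; rewrite psumr_eq0 => [/allP x0|i _]; last exact: sqr_ge0.
apply/matrixP => i j; rewrite ord1 mxE; apply/eqP.
by rewrite -sqrf_eq0; apply: x0; rewrite mem_index_enum.
Qed.

Lemma sqr_norm2Z n t (x : 'cV[R]_n) :
  norm2 (t *: x) ^+ 2 = t ^+ 2 * norm2 x ^+ 2.
Proof.
rewrite !sqr_sqrtr ?sumr_ge0 ?mulr_sumr// => *; rewrite ?sqr_ge0//.
by apply: eq_bigr => i _; rewrite mxE exprMn.
Qed.

Lemma qformD_sym n (M : 'M[R]_n) (x y : 'cV_n) t : M^T = M ->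
  qform M (x + t *: y) =
    qform M x + 2 * t * (x^T *m M *m y) 0 0 + t ^+ 2 * qform M y.
Proof.
move=> Msym; rewrite -qformZr /qform [(x + _)^T]linearD /=.
rewrite [(t *: y)^T]linearZ /= !mulmxDl !mulmxDr.
rewrite -!scalemxAl -!scalemxAr !mxE.
have sE : (y^T *m M *m x) 0 0 = (x^T *m M *m y) 0 0.
  (* A matrix of size 1 is its own transpose. *)
  have := mxE trmx_key (fun i j => (x^T *m M *m y) j i) 0 0.
  by rewrite -/(trmx (x^T *m M *m y)) !trmx_mul trmxK Msym mulmxA.
by move: sE; rewrite !mxE => ->; ring.
Qed.

Lemma qform_le_norm2 n (E : 'M[R]_n) :
  exists2 c, 0 < c & forall x : 'cV_n, qform E x <= c * norm2 x ^+ 2.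
Proof.
(* The leading 1 makes the constant positive even for E = 0. *)
exists (1 + \sum_i \sum_j `|E j i|) => [|x].
  by rewrite ltr_wpDr// sumr_ge0// => i _; rewrite sumr_ge0.
set s := norm2 x ^+ 2.
have sE : s = \sum_i x i 0 ^+ 2.
  by rewrite /s sqr_sqrtr ?sumr_ge0// => i _; exact: sqr_ge0.
have s_ge0 : 0 <= s by exact: sqr_ge0.
have xle i : x i 0 ^+ 2 <= s.
  by rewrite sE (bigD1 i)//= lerDl sumr_ge0// => j _; exact: sqr_ge0.
have xxle i j : `|x i 0 * x j 0| <= s.
  rewrite ler_norml; have := xle i; have := xle j.
  have := sqr_ge0 (x i 0 + x j 0); have := sqr_ge0 (x i 0 - x j 0).
  by move=> *; apply/andP; split; nra.
rewrite mulrDl mul1r; apply: ler_wpDl => //.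
rewrite /qform mxE mulr_suml; apply: ler_sum => i _.
rewrite mxE !mulr_suml; apply: ler_sum => j _.
rewrite mxE mulrAC mulrC; apply: le_trans (ler_norm _) _.
by rewrite normrM ler_wpM2l.
Qed.

(** Row space inclusion is dual to reverse inclusion of the null spaces of
column vectors: the columns of [cokermx B] span the null space of [B]. *)
Lemma submx_ker (F : fieldType) m1 m2 n (A : 'M[F]_(m1, n)) (B : 'M_(m2, n)) :
  (forall x : 'cV_n, B *m x = 0 -> A *m x = 0) -> (A <= B)%MS.
Proof.
move=> kerBA; rewrite submxE; apply/eqP/matrixP => i j.
have: A *m col j (cokermx B) = 0.
  by apply: kerBA; rewrite colE mulmxA mulmx_coker mul0mx.
by rewrite colE mulmxA -colE => /matrixP/(_ i 0); rewrite !mxE.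
Qed.

(** Since [G^T *m G] factors as M U G, put y = U G x and expand the form of [M]
at x + t y: the coefficient of the cross term is 2 |G x|^2, while y^T M y
depends on [x] only through [G *m x] and is thus at most c |G x|^2.
Nonnegativity at t = - 1/c then gives the bound with e = 1/c. *)
Lemma gram_le_psd m n (G : 'M[R]_(m, n)) (M : 'M_n) :
    M^T = M -> (forall x, 0 <= qform M x) -> (G^T *m G <= M)%MS ->
  exists2 e, 0 < e & forall x : 'cV_n, e * norm2 (G *m x) ^+ 2 <= qform M x.
Proof.
move=> Msym M_ge0 sQM; set U := (pinvmx M)^T *m G^T.
have QE : G^T *m G = M *m (U *m G).
  rewrite -[LHS]trmxK trmx_mul trmxK -(mulmxKpV sQM) trmx_mul Msym
    trmx_mul [(G^T *m G)^T]trmx_mul trmxK.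
  by rewrite /U !mulmxA.
have [c c_gt0 cP] := qform_le_norm2 (U^T *m M *m U).
exists c^-1 => [|x]; first by rewrite invr_gt0.
have := M_ge0 (x + (- c^-1) *: (U *m (G *m x))).
rewrite qformD_sym// -qform_congr.
have := cP (G *m x).
have -> : (x^T *m M *m (U *m (G *m x))) 0 0 = norm2 (G *m x) ^+ 2.
  by rewrite -qform_gram QE /qform !mulmxA.
set q := norm2 _ ^+ 2; set y := qform _ _; move=> yle M0.
have : (- c^-1) ^+ 2 * y <= c^-1 * q.
  rewrite sqrrN -[leRHS]mulr1 -[X in _ * _ * X](mulVf (lt0r_neq0 c_gt0)).
  have -> : c^-1 * q * (c^-1 * c) = c^-1 ^+ 2 * (c * q) by ring.
  by rewrite ler_wpM2l// sqr_ge0.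
move: M0; lra.
Qed.

End QuadraticForms.

Section Ratio.
Variables (R : realType) (n r l : nat).
Variables (Gx : 'M[R]_(n, l)) (Gr : 'M[R]_(r, l)).

(** Without division, the condition on the null space of [Gr] becomes
[Gx *m x = 0]: a direction that the residual does not see must be harmless. *)
Definition ratio_bound : set R :=
  [set t | forall x, norm2 (Gx *m x) ^+ 2 <= t * norm2 (Gr *m x) ^+ 2].

(** By homogeneity, a direction with [Gr *m x != 0] can be rescaled onto the
boundary of the stealthy set; one with [Gr *m x = 0] is stealthy at every
scale, so boundedness forces [Gx *m x = 0]. *)
Lemma ratio_bound_of_bounded delta :
  0 < delta -> bounded_attack_problem Gx Gr delta ->
  exists t, ratio_bound t.
Proof.
move=> d_gt0 [u uP].
have feas x t : t ^+ 2 * norm2 (Gr *m x) ^+ 2 <= delta ^+ 2 ->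
    t ^+ 2 * norm2 (Gx *m x) ^+ 2 <= u.
  move=> tx; rewrite -sqr_norm2Z scalemxAr; apply: uP; exists (t *: x) => //.
  by rewrite /stealthy_biases /= -scalemxAr sqr_norm2Z.
have d2_gt0 : 0 < delta ^+ 2 by rewrite exprn_gt0.
exists (u / delta ^+ 2) => x.
have := feas x; set a := norm2 (Gx *m x) ^+ 2; set b := norm2 (Gr *m x).
have a_ge0 : 0 <= a by exact: sqr_ge0.
move=> {}feas; have [b0|b0] := eqVneq b 0.
  rewrite b0 expr0n/= mulr0 leNgt; apply/negP => a_gt0.
  have u_ge0 : 0 <= u.
    by have := feas 0; rewrite expr0n/= !mul0r; apply; exact: ltW.
  (* This scale would give the impact u + 1, above the bound u. *)
  have := feas (Num.sqrt ((u + 1) / a)).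
  rewrite b0 expr0n/= mulr0 sqr_sqrtr ?divfK ?gt_eqF//; last first.
    by rewrite divr_ge0// addr_ge0.
  by move=> /(_ (ltW d2_gt0)); lra.
have b2_gt0 : 0 < b ^+ 2 by rewrite lt_def sqrf_eq0 b0 sqr_ge0.
have := feas (delta / b); rewrite expr_div_n divfK ?gt_eqF// => /(_ (lexx _)).
rewrite mulrAC ler_pdivrMr// => h.
by rewrite mulrAC ler_pdivlMr// mulrC.
Qed.

(** Each direction imposes a closed condition on [t], so the infimum of the
ratio bounds satisfies all of them.  The direction [v] seen by the residual
makes the set of ratio bounds bounded below. *)
Lemma least_ratio_bound t (v : 'cV_l) : ratio_bound t -> Gr *m v != 0 ->
  exists2 mu, ratio_bound mu & forall t, ratio_bound t -> mu <= t.
Proof.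
move=> tP Grv.
have nz x : Gr *m x != 0 -> 0 < norm2 (Gr *m x) ^+ 2.
  move=> x0; rewrite lt_def sqr_ge0 andbT.
  by apply: contra x0 => /eqP/norm2_sqr_eq0->.
have lbP x : Gr *m x != 0 ->
    lbound ratio_bound (norm2 (Gx *m x) ^+ 2 / norm2 (Gr *m x) ^+ 2).
  by move=> x0 s sP; rewrite ler_pdivrMr ?nz.
exists (inf ratio_bound) => [x|s sP]; last first.
  by apply: ge_inf => //; eexists; exact: lbP Grv.
have [x0|x0] := eqVneq (Gr *m x) 0.
  apply: le_trans (tP x) _; rewrite x0.
  suff -> : norm2 (0 : 'cV[R]_r) ^+ 2 = 0 by rewrite !mulr0.
  by rewrite -(scale0r (0 : 'cV[R]_r)) sqr_norm2Z expr0n mul0r.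
by rewrite -ler_pdivrMr ?nz//; apply: lb_le_inf; [exists t|exact: lbP].
Qed.

Let P := Gx^T *m Gx.
Let Q := Gr^T *m Gr.

(** A drop of rank is the only way in which [mu] can be least: otherwise
[mu *: Q - P] keeps the row space of [Q] and dominates a positive multiple of
[Q], which leaves room below [mu]. *)
Lemma least_ratio_bound_rank mu nu :
    ratio_bound mu -> (forall t, ratio_bound t -> mu <= t) -> mu < nu ->
  (\rank (P - mu *: Q)%R < \rank (P - nu *: Q)%R)%N.
Proof.
move=> muP mu_min mu_nu; rewrite ltnNge; apply/negP => rk.
have qfE t x :
    qform (t *: Q - P) x = t * norm2 (Gr *m x) ^+ 2 - norm2 (Gx *m x) ^+ 2.
  by rewrite qformB qformZl !qform_gram.
have sub_Q t : (P - t *: Q <= Q)%MS.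
  apply: submx_ker => x Qx0.
  have Gx0 : Gx *m x = 0.
    apply: norm2_sqr_eq0; apply/eqP; rewrite eq_le sqr_ge0 andbT.
    apply: le_trans (muP x) _.
    by rewrite -qform_gram /qform -mulmxA Qx0 mulmx0 mxE mulr0.
  by rewrite mulmxBl -scalemxAl Qx0 scaler0 subr0 -mulmxA Gx0 mulmx0.
have Q_sub : (Q <= P - nu *: Q)%MS.
  apply: submx_ker => x Mx0.
  suff Gr0 : Gr *m x = 0 by rewrite -mulmxA Gr0 mulmx0.
  apply: norm2_sqr_eq0; have := qfE nu x.
  rewrite /qform -mulmxA -opprB mulNmx Mx0 oppr0 mulmx0 mxE => nu0.
  apply/eqP; rewrite eq_le sqr_ge0 andbT; have := muP x.
  by move: (sqr_ge0 (norm2 (Gr *m x))) => *; nra.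
have Q_sub_mu : (Q <= mu *: Q - P)%MS.
  rewrite -opprB (eqmx_opp _) -(mxrank_leqif_sup (sub_Q mu)).
  rewrite eqn_leq (mxrankS (sub_Q mu)) /=.
  exact: leq_trans (mxrankS Q_sub) rk.
have sym : (mu *: Q - P)^T = mu *: Q - P.
  by rewrite linearB /= linearZ /= !trmx_mul !trmxK.
have [x|e e_gt0 eP] := gram_le_psd sym _ Q_sub_mu.
  by rewrite qfE subr_ge0.
have /mu_min : ratio_bound (mu - e).
  by move=> x; have := eP x; rewrite qfE mulrBl; lra.
by rewrite lerBrDr gerDl leNgt e_gt0.
Qed.

(** The least ratio bound is a generalized eigenvalue of the complexified
pencil: its rank there lies below the rank at some real [nu > mu], and [nu]
can be chosen to realize the normal rank because only finitely many values fail
to. *)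
Lemma least_ratio_bound_le mu lam :
    ratio_bound mu -> (forall t, ratio_bound t -> mu <= t) ->
  largest_generalized_eigenvalue P Q lam -> mu <= lam.
Proof.
move=> muP mu_min [[k k_nr _] lam_max]; apply: lam_max; exists k => //.
have rkE t : \rank (map_mx (real_complex R) P -
    real_complex R t *: map_mx (real_complex R) Q) = \rank (P - t *: Q).
  by rewrite -map_mxZ -map_mxB mxrank_map.
have [nu mu_nu <-] : exists2 nu, mu < nu & \rank (P - nu *: Q) = k.
  apply: contrapT => no_nu.
  apply: infinite_nat.
  pose f (i : nat) := real_complex R (mu + i.+1%:R).
  have f_inj : injective f.
    by move=> i j /complexI /addrI /eqP; rewrite eqr_nat => /eqP[].
  have := finite_preimage (in2W f_inj) k_nr.
  apply: sub_finite_set => i _ /=; rewrite rkE => rk.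
  by apply: no_nu; exists (mu + i.+1%:R) => //; rewrite ltrDl ltr0n.
by rewrite rkE; exact: least_ratio_bound_rank.
Qed.

End Ratio.

Theorem theorem12 (R : realType) (n m p q r l : nat)
  (A : 'M[R]_n) (B : 'M[R]_(n, p)) (C : 'M[R]_(q, n))
  (Ac : 'M[R]_m) (Bc : 'M[R]_(m, q)) (Cc : 'M[R]_(p, m)) (Dc : 'M[R]_(p, q))
  (K : 'M[R]_(n, q)) (V : 'M[R]_(r, q))
  (Ba : 'M[R]_(n + m, l)) (Be : 'M[R]_(n, l)) (De : 'M[R]_(r, l))
  (delta : R) (lam : R) (v : 'cV[R]_l) :
  let Gxa := gain_xa A B C Ac Bc Cc Dc Ba in
  let Gra := gain_ra A C K V Be De in
  1%:M - closed_loop_mx A B C Ac Bc Cc Dc \in unitmx ->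
  1%:M - error_mx A C K \in unitmx ->
  0 < delta ->
  bounded_attack_problem Gxa Gra delta ->
  largest_generalized_eigenvalue (Gxa^T *m Gxa) (Gra^T *m Gra) lam ->
  generalized_eigenvector (Gxa^T *m Gxa) (Gra^T *m Gra) lam v ->
  norm2 v = 1 ->
  forall a : 'cV[R]_l,
    a = (delta / norm2 (Gra *m v)) *: v \/
    a = - ((delta / norm2 (Gra *m v)) *: v) ->
    [/\ optimal_attack Gxa Gra delta a,
        norm2 (Gxa *m a) ^+ 2 = lam * delta ^+ 2 &
        safe_set2 (Gxa *m a) <-> lam * delta ^+ 2 <= 1].
Proof.
move=> Gxa Gra _ _ d_gt0 bnd lam_max [v_ker Qv0] _ a aE.
have Grv : Gra *m v != 0.
  by apply: contra_notN Qv0 => /eqP Grv; rewrite -mulmxA Grv mulmx0.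
have g_gt0 : 0 < norm2 (Gra *m v) ^+ 2.
  by rewrite lt_def sqr_ge0 andbT; apply: contra Grv => /eqP/norm2_sqr_eq0->.
have vE : norm2 (Gxa *m v) ^+ 2 = lam * norm2 (Gra *m v) ^+ 2.
  apply/eqP; rewrite -subr_eq0 -!qform_gram -qformZl -qformB.
  by rewrite /qform -mulmxA v_ker mulmx0 mxE.
have lam_ge0 : 0 <= lam by rewrite -(pmulr_lge0 _ g_gt0) -vE sqr_ge0.
have [t tP] := ratio_bound_of_bounded d_gt0 bnd.
have [mu muP mu_min] := least_ratio_bound tP Grv.
have mu_lam := least_ratio_bound_le muP mu_min lam_max.
have aN k (G : 'M[R]_(k, l)) : norm2 (G *m a) ^+ 2 =
    delta ^+ 2 / norm2 (Gra *m v) ^+ 2 * norm2 (G *m v) ^+ 2.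
  by case: aE => ->; rewrite -?scaleNr -scalemxAr sqr_norm2Z ?sqrrN expr_div_n.
have aE2 : norm2 (Gxa *m a) ^+ 2 = lam * delta ^+ 2.
  by rewrite aN vE mulrCA divfK// gt_eqF.
split => //; last by rewrite /safe_set2 /= aE2.
split => [|b b_st]; first by rewrite /stealthy_biases /= aN divfK// gt_eqF.
rewrite /impact aE2; apply: le_trans (muP b) _.
apply: le_trans (ler_wpM2l lam_ge0 b_st).
by rewrite ler_wpM2r ?sqr_ge0.
Qed.
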